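(* Let $K$ be a field, $\lambda\in K$, and let $(C,\mu,\Delta,\alpha,\beta,\psi,\omega)$ be a $\lambda$-infBH-bialgebra over $K$ such that $\alpha,\beta,\psi,\omega$ are invertible. Then $(C,\Delta_\star,\psi,\omega)$ is a (left) BiHom-pre-Lie coalgebra, where $\Delta_\star:C\to C\otimes C$ is given by $$\Delta_\star(c)=\psi^{-1}(c_{12})\otimes\alpha^{-1}\psi\omega^{-2}(c_{11})\,\beta^{-1}(c_2),\qquad c\in C.$$
   Context: Write $ab=\mu(a\otimes b)$, $\Delta(c)=c_1\otimes c_2$ and $(\Delta\otimes\mathrm{id})\Delta(c)=c_{11}\otimes c_{12}\otimes c_2$ (Sweedler notation). A $\lambda$-infBH-bialgebra $(C,\mu,\Delta,\alpha,\beta,\psi,\omega)$ consists of a vector space $C$ and linear maps $\mu:C\otimes C\to C$, $\Delta:C\to C\otimes C$, $\alpha,\beta,\psi,\omega:C\to C$ such that: (i) (BiHom-associative algebra) $\alpha\beta=\beta\alpha$, $\alpha(ab)=\alpha(a)\alpha(b)$, $\beta(ab)=\beta(a)\beta(b)$, $\alpha(a)(bc)=(ab)\beta(c)$; (ii) (BiHom-coassociative coalgebra) $\psi\omega=\omega\psi$, $(\psi\otimes\psi)\Delta=\Delta\psi$, $(\omega\otimes\omega)\Delta=\Delta\omega$, $(\Delta\otimes\psi)\Delta=(\omega\otimes\Delta)\Delta$; (iii) $\alpha,\beta$ commute with $\psi,\omega$; $(\alpha\otimes\alpha)\Delta=\Delta\alpha$, $(\beta\otimes\beta)\Delta=\Delta\beta$;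 $\psi(ab)=\psi(a)\psi(b)$, $\omega(ab)=\omega(a)\omega(b)$; (iv) $\Delta(ab)=\omega(a)b_1\otimes\beta(b_2)+\alpha(a_1)\otimes a_2\psi(b)+\lambda\,\alpha\omega(a)\otimes\beta\psi(b)$. A (left) BiHom-pre-Lie coalgebra $(C,\delta,\psi,\omega)$ consists of a vector space $C$ and linear maps $\delta:C\to C\otimes C$ (written $\delta(c)=c_{[1]}\otimes c_{[2]}$), $\psi,\omega:C\to C$ with $\psi\omega=\omega\psi$, $\delta\psi=(\psi\otimes\psi)\delta$, $\delta\omega=(\omega\otimes\omega)\delta$ and $\bar\delta-\Phi_{(12)}\bar\delta=0$, where $\bar\delta(c)=\omega\psi(c_{[1]})\otimes\omega(c_{[2][1]})\otimes c_{[2][2]}-\psi(c_{[1][1]})\otimes\omega(c_{[1][2]})\otimes\psi(c_{[2]})$ and $\Phi_{(12)}(a\otimes b\otimes c)=b\otimes a\otimes c$. *)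

(* Defs.v *)
From HB Require Import structures.
From mathcomp Require Import all_boot all_order all_algebra.
From mathcomp Require Import boolp.

Set Implicit Arguments.
Unset Strict Implicit.
Unset Printing Implicit Defensive.

Import GRing.Theory.
Local Open Scope ring_scope.
Local Open Scope quotient_scope.

Reserved Notation "x ⊗ y" (at level 40, left associativity).

(** A list [:: (u1, v1); ...; (un, vn)] stands for the formal sum of the
    ui ⊗ vi, and [tensor U V] is the quotient of the lists by the congruence that
    makes concatenation commutative and the generators bilinear.  The universal
    property is given by [tlift], [tliftE] and [tens_ext]. *)

Section TensorDef.
Variables (K : fieldType) (U V : lmodType K).

Inductive tens_rel : seq (U * V) -> seq (U * V) -> Prop :=
| TensRefl s : tens_rel s s
| TensSym s t : tens_rel s t -> tens_rel t s
| TensTrans s t r : tens_rel s t -> tens_rel t r -> tens_rel s r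
| TensCat s s' t t' :
    tens_rel s s' -> tens_rel t t' -> tens_rel (s ++ t) (s' ++ t')
| TensCatC s t : tens_rel (s ++ t) (t ++ s)
| TensAddl u u' v : tens_rel [:: (u + u', v)] [:: (u, v); (u', v)]
| TensAddr u v v' : tens_rel [:: (u, v + v')] [:: (u, v); (u, v')]
| TensScale a u v : tens_rel [:: (a *: u, v)] [:: (u, a *: v)]
| TensZero v : tens_rel [:: (0, v)] [::].

Definition tens_relb (s t : seq (U * V)) : bool := `[< tens_rel s t >].

Lemma tens_relb_refl : reflexive tens_relb.
Proof. by move=> s; apply/asboolP; apply: TensRefl. Qed.

Lemma tens_relb_sym : symmetric tens_relb.
Proof. by move=> s t; apply/asboolP/asboolP; apply: TensSym. Qed.

Lemma tens_relb_trans : transitive tens_relb.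
Proof.
by move=> t s r /asboolP st /asboolP tr; apply/asboolP; apply: TensTrans st tr.
Qed.

Canonical tens_equiv :=
  EquivRel tens_relb tens_relb_refl tens_relb_sym tens_relb_trans.

Definition tensor : Type := {eq_quot tens_equiv}.

HB.instance Definition _ := Choice.on tensor.
HB.instance Definition _ := Quotient.on tensor.

Definition tens_class (s : seq (U * V)) : tensor := \pi_tensor s.
Definition tens_repr (t : tensor) : seq (U * V) := repr t.

Lemma tens_reprK : cancel tens_repr tens_class.
Proof. exact: reprK. Qed.

Lemma tens_classP (s t : seq (U * V)) :
  tens_class s = tens_class t <-> tens_rel s t.
Proof.
split; first by move/(@eqquotP _ tens_equiv {eq_quot tens_equiv})/asboolP.
by move=> st; apply/(@eqquotP _ tens_equiv {eq_quot tens_equiv})/asboolP.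
Qed.

Lemma tens_repr_class (s : seq (U * V)) : tens_rel (tens_repr (tens_class s)) s.
Proof. by apply/tens_classP; rewrite tens_reprK. Qed.

Definition formal_scale (a : K) (s : seq (U * V)) : seq (U * V) :=
  [seq (a *: p.1, p.2) | p <- s].

Lemma formal_scale_rel a s t :
  tens_rel s t -> tens_rel (formal_scale a s) (formal_scale a t).
Proof.
rewrite /formal_scale; elim=> {s t} [s|s t _|s t r _ IH1 _ IH2|s s' t t' _ IH1 _ IH2|s t
  |u u' v|u v v'|b u v|v] //=.
- exact: TensRefl.
- exact: TensSym.
- exact: TensTrans IH1 IH2.
- by rewrite !map_cat; apply: TensCat.
- by rewrite !map_cat; apply: TensCatC.
- by rewrite scalerDr; apply: TensAddl.
- exact: TensAddr.
- by rewrite scalerA mulrC -scalerA; apply: TensScale.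
- by rewrite scaler0; apply: TensZero.
Qed.

Lemma formal_scale1 s : formal_scale 1 s = s.
Proof. by rewrite /formal_scale -[RHS]map_id; apply: eq_map => -[u v]; rewrite scale1r. Qed.

Lemma formal_scaleA a b s :
  formal_scale a (formal_scale b s) = formal_scale (a * b) s.
Proof. by rewrite /formal_scale -map_comp; apply: eq_map => p /=; rewrite scalerA. Qed.

Lemma formal_scaleDl a b s :
  tens_rel (formal_scale (a + b) s) (formal_scale a s ++ formal_scale b s).
Proof.
elim: s => [|[u v] s IH] /=; first exact: TensRefl.
rewrite scalerDl -cat1s -[_ :: _ ++ _]cat1s -[X in _ ++ (_ ++ X)]cat1s.
apply: (@TensTrans _ ([:: (a *: u, v); (b *: u, v)] ++
   (formal_scale a s ++ formal_scale b s))).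
  by apply: TensCat => //; apply: TensAddl.
rewrite -[X in X ++ _]cat1s -catA; apply: TensCat; first exact: TensRefl.
rewrite !catA; apply: TensCat; last exact: TensRefl.
exact: TensCatC.
Qed.

Lemma formal_scale0 s : tens_rel (formal_scale 0 s) [::].
Proof.
elim: s => [|[u v] s IH] /=; first exact: TensRefl.
rewrite scale0r -cat1s -[X in tens_rel _ X]cat0s.
by apply: TensCat => //; apply: TensZero.
Qed.

Definition tens_zero : tensor := tens_class [::].
Definition tens_add (x y : tensor) : tensor :=
  tens_class (tens_repr x ++ tens_repr y).
Definition tens_scale (a : K) (x : tensor) : tensor :=
  tens_class (formal_scale a (tens_repr x)).
Definition tens_opp (x : tensor) : tensor := tens_scale (- 1) x.

Lemma tens_addE s t : tens_add (tens_class s) (tens_class t) = tens_class (s ++ t).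
Proof. by apply/tens_classP; apply: TensCat; apply: tens_repr_class. Qed.

Lemma tens_scaleE a s : tens_scale a (tens_class s) = tens_class (formal_scale a s).
Proof. by apply/tens_classP; apply/formal_scale_rel/tens_repr_class. Qed.

Lemma tens_addA : associative tens_add.
Proof.
by move=> x y z; rewrite -(tens_reprK x) -(tens_reprK y) -(tens_reprK z) !tens_addE catA.
Qed.

Lemma tens_addC : commutative tens_add.
Proof.
move=> x y; rewrite -(tens_reprK x) -(tens_reprK y) !tens_addE.
by apply/tens_classP; apply: TensCatC.
Qed.

Lemma tens_add0 : left_id tens_zero tens_add.
Proof. by move=> x; rewrite -(tens_reprK x) tens_addE. Qed.

Lemma tens_addN : left_inverse tens_zero tens_opp tens_add.
Proof.
move=> x; rewrite -(tens_reprK x) /tens_opp tens_scaleE tens_addE.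
apply/tens_classP; rewrite -[X in _ ++ X]formal_scale1.
apply: TensTrans (formal_scale0 (tens_repr x)); apply: TensSym.
by rewrite -(addNr 1); apply: formal_scaleDl.
Qed.

HB.instance Definition _ :=
  GRing.isZmodule.Build tensor tens_addA tens_addC tens_add0 tens_addN.

Lemma tens_scaleA a b x : tens_scale a (tens_scale b x) = tens_scale (a * b) x.
Proof. by rewrite -(tens_reprK x) !tens_scaleE formal_scaleA. Qed.

Lemma tens_scale1 : left_id 1 tens_scale.
Proof. by move=> x; rewrite -(tens_reprK x) tens_scaleE formal_scale1. Qed.

Lemma tens_scaleDr : right_distributive tens_scale +%R.
Proof.
move=> a x y; change (tens_scale a (tens_add x y) =
  tens_add (tens_scale a x) (tens_scale a y)).
rewrite -(tens_reprK x) -(tens_reprK y) tens_addE !tens_scaleE tens_addE.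
by rewrite /formal_scale map_cat.
Qed.

Lemma tens_scaleDl x : {morph tens_scale^~ x : a b / a + b}.
Proof.
move=> a b; change (tens_scale (a + b) x = tens_add (tens_scale a x) (tens_scale b x)).
rewrite -(tens_reprK x) !tens_scaleE tens_addE.
by apply/tens_classP; apply: formal_scaleDl.
Qed.

HB.instance Definition _ := GRing.Zmodule_isLmodule.Build K tensor
  tens_scaleA tens_scale1 tens_scaleDr tens_scaleDl.

Definition tens (u : U) (v : V) : tensor := tens_class [:: (u, v)].

Lemma tens_bilinear : bilinear_for *:%R *:%R tens.
Proof.
split=> [v a u u'|u a v v'] /=; rewrite /tens.
- change (tens_class [:: (a *: u + u', v)] =
    tens_add (tens_scale a (tens_class [:: (u, v)])) (tens_class [:: (u', v)])).
  by rewrite tens_scaleE tens_addE; apply/tens_classP; apply: TensAddl.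
- change (tens_class [:: (u, a *: v + v')] =
    tens_add (tens_scale a (tens_class [:: (u, v)])) (tens_class [:: (u, v')])).
  rewrite tens_scaleE tens_addE; apply/tens_classP => /=.
  apply: TensTrans (TensAddr _ _ _) _.
  rewrite -cat1s -[X in tens_rel _ X]cat1s; apply: TensCat; last exact: TensRefl.
  by apply: TensSym; apply: TensScale.
Qed.

HB.instance Definition _ := bilinear_isBilinear.Build K U V tensor *:%R *:%R tens
  tens_bilinear.

Lemma tens_class_sum s : tens_class s = \sum_(p <- s) tens p.1 p.2.
Proof.
elim: s => [|[u v] s IH]; first by rewrite big_nil.
by rewrite big_cons -IH -cat1s -tens_addE.
Qed.

Lemma tensP (t : tensor) : exists s : seq (U * V), t = \sum_(p <- s) tens p.1 p.2.
Proof. by exists (tens_repr t); rewrite -tens_class_sum tens_reprK. Qed.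

End TensorDef.

Notation "u ⊗ v" := (tens u v) : ring_scope.

Section UniversalProperty.
Variables (K : fieldType) (U V W : lmodType K).

Lemma tens_ext (f g : {linear tensor U V -> W}) :
  (forall u v, f (u ⊗ v) = g (u ⊗ v)) -> f =1 g.
Proof.
move=> fg t; have [s ->] := tensP t.
by rewrite !linear_sum; apply: eq_bigr => p _; apply: fg.
Qed.

Definition tlift (f : {bilinear U -> V -> W}) (t : tensor U V) : W :=
  \sum_(p <- tens_repr t) f p.1 p.2.

Lemma tens_rel_sum (f : {bilinear U -> V -> W}) s t : tens_rel s t ->
  \sum_(p <- s) f p.1 p.2 = \sum_(p <- t) f p.1 p.2.
Proof.
elim=> {s t} [s|s t _ ->|s t r _ -> _ ->|s s' t t' _ IH1 _ IH2|s t
  |u u' v|u v v'|a u v|v] //.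
- by rewrite !big_cat /= IH1 IH2.
- by rewrite !big_cat /= addrC.
- by rewrite !big_cons !big_nil !addr0 linearDl.
- by rewrite !big_cons !big_nil !addr0 linearDr.
- by rewrite !big_cons !big_nil !addr0 linearZl_LR linearZr.
- by rewrite !big_cons !big_nil addr0 linear0l.
Qed.

Lemma tlift_class (f : {bilinear U -> V -> W}) s :
  tlift f (tens_class s) = \sum_(p <- s) f p.1 p.2.
Proof. exact/tens_rel_sum/tens_repr_class. Qed.

Lemma tlift_is_linear (f : {bilinear U -> V -> W}) : linear (tlift f).
Proof.
move=> a x y; rewrite -(tens_reprK x) -(tens_reprK y).
have -> : a *: tens_class (tens_repr x) + tens_class (tens_repr y) =
    tens_class (formal_scale a (tens_repr x) ++ tens_repr y).
  by rewrite -tens_addE -tens_scaleE.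
rewrite !tlift_class big_cat scaler_sumr big_map; congr (_ + _).
by apply: eq_bigr => p _ /=; rewrite linearZl_LR.
Qed.

HB.instance Definition _ (f : {bilinear U -> V -> W}) :=
  GRing.isLinear.Build K (tensor U V) W *:%R (tlift f) (tlift_is_linear f).

Lemma tliftE (f : {bilinear U -> V -> W}) u v : tlift f (u ⊗ v) = f u v.
Proof. by rewrite tlift_class big_cons big_nil addr0. Qed.

End UniversalProperty.

Section TensorMap.
Variables (K : fieldType) (U U' V V' : lmodType K).
Variables (f : {linear U -> U'}) (g : {linear V -> V'}).

Definition tmap_fun (u : U) (v : V) : tensor U' V' := f u ⊗ g v.

Lemma tmap_bilinear : bilinear_for *:%R *:%R tmap_fun.
Proof.
split=> [v|u] a x y; rewrite /tmap_fun /= linearP.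
- by rewrite linearPl.
- by rewrite linearPr.
Qed.

HB.instance Definition _ := bilinear_isBilinear.Build K U V (tensor U' V')
  *:%R *:%R tmap_fun tmap_bilinear.

Definition tmap : {linear tensor U V -> tensor U' V'} := tlift tmap_fun.

Lemma tmapE u v : tmap (u ⊗ v) = f u ⊗ g v.
Proof. exact: tliftE. Qed.

End TensorMap.

Section TensorSwap.
Variables (K : fieldType) (U V : lmodType K).

Definition tswap_fun (u : U) (v : V) : tensor V U := v ⊗ u.

Lemma tswap_bilinear : bilinear_for *:%R *:%R tswap_fun.
Proof.
by split=> [v|u] a x y; rewrite /tswap_fun /= ?linearPl ?linearPr.
Qed.

HB.instance Definition _ := bilinear_isBilinear.Build K U V (tensor V U)
  *:%R *:%R tswap_fun tswap_bilinear.

Definition tswap : {linear tensor U V -> tensor V U} := tlift tswap_fun.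

Lemma tswapE u v : tswap (u ⊗ v) = v ⊗ u.
Proof. exact: tliftE. Qed.

End TensorSwap.

Arguments tswap {K U V}.

Section TensorSlices.
Variables (K : fieldType) (U V : lmodType K).

Definition ltens (u : U) (v : V) : tensor U V := u ⊗ v.
Definition rtens (v : V) (u : U) : tensor U V := u ⊗ v.

Lemma ltens_linear u : linear (ltens u).
Proof. by move=> a x y; rewrite /ltens linearPr. Qed.

Lemma rtens_linear v : linear (rtens v).
Proof. by move=> a x y; rewrite /rtens linearPl. Qed.

HB.instance Definition _ u :=
  GRing.isLinear.Build K V (tensor U V) *:%R (ltens u) (ltens_linear u).
HB.instance Definition _ v :=
  GRing.isLinear.Build K U (tensor U V) *:%R (rtens v) (rtens_linear v).

End TensorSlices.

Section TensorAssoc.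
Variables (K : fieldType) (U V W : lmodType K).

Definition tassoc_fun (t : tensor U V) (w : W) : tensor U (tensor V W) :=
  tmap idfun (rtens w) t.

Definition tassocV_fun (u : U) (t : tensor V W) : tensor (tensor U V) W :=
  tmap (ltens u) idfun t.

Lemma tassoc_bilinear : bilinear_for *:%R *:%R tassoc_fun.
Proof.
split=> [w|t] a x y; rewrite /tassoc_fun /=; first exact: linearP.
have [s ->] := tensP t.
have sumE z : tmap idfun (rtens z) (\sum_(p <- s) p.1 ⊗ p.2) =
    \sum_(p <- s) p.1 ⊗ (p.2 ⊗ z).
  by rewrite linear_sum; apply: eq_bigr => p _; rewrite tmapE.
rewrite !sumE scaler_sumr -big_split /=.
by apply: eq_bigr => p _; rewrite !linearPr.
Qed.

Lemma tassocV_bilinear : bilinear_for *:%R *:%R tassocV_fun.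
Proof.
split=> [t|u] a x y; rewrite /tassocV_fun /=; last exact: linearP.
have [s ->] := tensP t.
have sumE z : tmap (ltens z) idfun (\sum_(p <- s) p.1 ⊗ p.2) =
    \sum_(p <- s) (z ⊗ p.1) ⊗ p.2.
  by rewrite linear_sum; apply: eq_bigr => p _; rewrite tmapE.
rewrite !sumE scaler_sumr -big_split /=.
by apply: eq_bigr => p _; rewrite !linearPl.
Qed.

HB.instance Definition _ := bilinear_isBilinear.Build K (tensor U V) W
  (tensor U (tensor V W)) *:%R *:%R tassoc_fun tassoc_bilinear.
HB.instance Definition _ := bilinear_isBilinear.Build K U (tensor V W)
  (tensor (tensor U V) W) *:%R *:%R tassocV_fun tassocV_bilinear.

Definition tassoc : {linear tensor (tensor U V) W -> tensor U (tensor V W)} :=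
  tlift tassoc_fun.
Definition tassocV : {linear tensor U (tensor V W) -> tensor (tensor U V) W} :=
  tlift tassocV_fun.

Lemma tassocE u v w : tassoc ((u ⊗ v) ⊗ w) = u ⊗ (v ⊗ w).
Proof. by apply: etrans (tliftE _ _ _) _; apply: tmapE. Qed.

Lemma tassocVE u v w : tassocV (u ⊗ (v ⊗ w)) = (u ⊗ v) ⊗ w.
Proof. by apply: etrans (tliftE _ _ _) _; apply: tmapE. Qed.

Lemma tens_ext3l (X : lmodType K)
    (f g : {linear tensor (tensor U V) W -> X}) :
  (forall u v w, f ((u ⊗ v) ⊗ w) = g ((u ⊗ v) ⊗ w)) -> f =1 g.
Proof.
move=> fg; apply: tens_ext => t w.
by apply: (tens_ext (f := f \o rtens w) (g := g \o rtens w)) => u v; apply: fg.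
Qed.

Lemma tens_ext3r (X : lmodType K)
    (f g : {linear tensor U (tensor V W) -> X}) :
  (forall u v w, f (u ⊗ (v ⊗ w)) = g (u ⊗ (v ⊗ w))) -> f =1 g.
Proof.
move=> fg; apply: tens_ext => u t.
by apply: (tens_ext (f := f \o ltens u) (g := g \o ltens u)) => v w; apply: fg.
Qed.

Lemma tassocK : cancel tassoc tassocV.
Proof.
apply: (tens_ext3l (f := tassocV \o tassoc) (g := idfun)) => u v w.
by apply: etrans (congr1 tassocV (tassocE u v w)) _; apply: tassocVE.
Qed.

Lemma tassocVK : cancel tassocV tassoc.
Proof.
apply: (tens_ext3r (f := tassoc \o tassocV) (g := idfun)) => u v w.
by apply: etrans (congr1 tassoc (tassocVE u v w)) _; apply: tassocE.
Qed.

End TensorAssoc.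

Arguments tassoc {K U V W}.
Arguments tassocV {K U V W}.

Section LinearInverse.
Variables (K : fieldType) (U V : lmodType K).
Variables (f : {linear U -> V}) (fbij : bijective f).

Lemma linv_exists : exists g : V -> U, cancel f g /\ cancel g f.
Proof. by have [g fK gK] := fbij; exists g. Qed.

Definition linv : V -> U := sval (cid linv_exists).

Lemma linvK : cancel f linv.
Proof. exact: (svalP (cid linv_exists)).1. Qed.

Lemma linvVK : cancel linv f.
Proof. exact: (svalP (cid linv_exists)).2. Qed.

Lemma linv_linear : linear linv.
Proof. by move=> a x y; apply: (can_inj linvK); rewrite linearP !linvVK. Qed.

HB.instance Definition _ := GRing.isLinear.Build K V U *:%R linv linv_linear.

End LinearInverse.

Section BiHom.
Variables (K : fieldType) (C : lmodType K).

Section Algebra.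
Variables (mu : {linear tensor C C -> C}) (alpha beta : {linear C -> C}).
Local Notation "a · b" := (mu (a ⊗ b)) (at level 40, left associativity).

Record BiHom_associative_algebra : Prop := {
  bha_comm a : alpha (beta a) = beta (alpha a);
  bha_alphaM a b : alpha (a · b) = alpha a · alpha b;
  bha_betaM a b : beta (a · b) = beta a · beta b;
  bha_assoc a b c : alpha a · (b · c) = (a · b) · beta c
}.

End Algebra.

Section Coalgebra.
Variables (Delta : {linear C -> tensor C C}) (psi omega : {linear C -> C}).

(* Threefold tensors are bracketed to the left; [tassocV] moves the values of
   [omega ⊗ Delta] there. *)
Record BiHom_coassociative_coalgebra : Prop := {
  bhc_comm c : psi (omega c) = omega (psi c);
  bhc_psi c : tmap psi psi (Delta c) = Delta (psi c);
  bhc_omega c : tmap omega omega (Delta c) = Delta (omega c);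
  bhc_coassoc c : tmap Delta psi (Delta c) = tassocV (tmap omega Delta (Delta c))
}.

End Coalgebra.

Section InfBHBialgebra.
Variables (lambda : K).
Variables (mu : {linear tensor C C -> C}) (Delta : {linear C -> tensor C C}).
Variables (alpha beta psi omega : {linear C -> C}).
Local Notation "a · b" := (mu (a ⊗ b)) (at level 40, left associativity).

(* In [ibb_Delta_mul], [mu \o ltens x] and [mu \o rtens y] are the left
   multiplication by x and the right multiplication by y. *)
Record infBH_bialgebra : Prop := {
  ibb_algebra : BiHom_associative_algebra mu alpha beta;
  ibb_coalgebra : BiHom_coassociative_coalgebra Delta psi omega;
  ibb_alpha_psi c : alpha (psi c) = psi (alpha c);
  ibb_alpha_omega c : alpha (omega c) = omega (alpha c);
  ibb_beta_psi c : beta (psi c) = psi (beta c);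
  ibb_beta_omega c : beta (omega c) = omega (beta c);
  ibb_alpha_Delta c : tmap alpha alpha (Delta c) = Delta (alpha c);
  ibb_beta_Delta c : tmap beta beta (Delta c) = Delta (beta c);
  ibb_psiM a b : psi (a · b) = psi a · psi b;
  ibb_omegaM a b : omega (a · b) = omega a · omega b;
  ibb_Delta_mul a b :
    Delta (a · b) = tmap (mu \o ltens (omega a)) beta (Delta b)
                  + tmap alpha (mu \o rtens (psi b)) (Delta a)
                  + lambda *: (alpha (omega a) ⊗ beta (psi b))
}.

End InfBHBialgebra.

Section PreLieCoalgebra.
Variables (delta : {linear C -> tensor C C}) (psi omega : {linear C -> C}).

Definition delta_bar (c : C) : tensor (tensor C C) C :=
  tassocV (tmap (omega \o psi) (tmap omega idfun \o delta) (delta c))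
  - tmap (tmap psi omega \o delta) psi (delta c).

Definition Phi12 : {linear tensor (tensor C C) C -> tensor (tensor C C) C} :=
  tmap tswap idfun.

Lemma Phi12E a b c : Phi12 ((a ⊗ b) ⊗ c) = (b ⊗ a) ⊗ c.
Proof. by rewrite /Phi12 tmapE tswapE. Qed.

Record BiHom_preLie_coalgebra : Prop := {
  bhp_comm c : psi (omega c) = omega (psi c);
  bhp_psi c : delta (psi c) = tmap psi psi (delta c);
  bhp_omega c : delta (omega c) = tmap omega omega (delta c);
  bhp_preLie c : delta_bar c - Phi12 (delta_bar c) = 0
}.

End PreLieCoalgebra.

Section DeltaStar.
Variables (mu : {linear tensor C C -> C}) (Delta : {linear C -> tensor C C}).
Variables (alpha beta psi omega : {linear C -> C}).
Hypotheses (alpha_bij : bijective alpha) (beta_bij : bijective beta).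
Hypotheses (psi_bij : bijective psi) (omega_bij : bijective omega).

Definition star_map : {linear tensor (tensor C C) C -> tensor C C} :=
  tmap (linv psi_bij)
       (mu \o tmap (linv alpha_bij \o psi \o linv omega_bij \o linv omega_bij)
                   (linv beta_bij))
  \o tassoc \o tmap tswap idfun.

Lemma star_mapE c11 c12 c2 :
  star_map ((c11 ⊗ c12) ⊗ c2) =
  linv psi_bij c12 ⊗
    mu (linv alpha_bij (psi (linv omega_bij (linv omega_bij c11)))
        ⊗ linv beta_bij c2).
Proof.
change (tmap (linv psi_bij)
  (mu \o tmap (linv alpha_bij \o psi \o linv omega_bij \o linv omega_bij)
              (linv beta_bij)) (tassoc (tmap tswap idfun ((c11 ⊗ c12) ⊗ c2))) =
  linv psi_bij c12 ⊗
    mu (linv alpha_bij (psi (linv omega_bij (linv omega_bij c11)))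
        ⊗ linv beta_bij c2)).
rewrite tmapE tswapE tassocE tmapE; congr (_ ⊗ _).
by apply: (congr1 mu); apply: tmapE.
Qed.

Definition Delta_star : {linear C -> tensor C C} :=
  star_map \o tmap Delta idfun \o Delta.

End DeltaStar.

End BiHom.

(* Main.v *)
(** Since the structure maps are invertible, everything is a twist of the ordinary
    case.  The product x * y = alpha^-1(x) beta^-1(y) and the coproduct
    Delta0 = (omega^-1 ⊗ psi^-1) Delta form an ordinary infinitesimal bialgebra of
    weight lambda, on which alpha, beta, psi, omega act by commuting automorphisms.
    Moreover Delta_star = (omega ⊗ psi) delta0 with delta0 c = c2 ⊗ (c1 * c3), and
    delta_bar for Delta_star is the image of delta_bar for delta0 under
    omega^2 psi ⊗ omega^2 psi ⊗ psi^2, so it suffices that the latter is symmetric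
    in its first two factors.  This follows by expanding Delta0 (c1 * c3). *)
Require Import Defs.
From HB Require Import structures.
From mathcomp Require Import all_boot all_order all_algebra.

Set Implicit Arguments.
Unset Strict Implicit.
Unset Printing Implicit Defensive.

Import GRing.Theory.
Local Open Scope ring_scope.

(** * Functoriality of [tmap], and linear maps out of a tensor product *)

Section TensorMapTheory.
Variable K : fieldType.

Lemma tmap_comp (U U' U'' V V' V'' : lmodType K)
    (f : {linear U -> U'}) (f' : {linear U' -> U''})
    (g : {linear V -> V'}) (g' : {linear V' -> V''}) t :
  tmap f' g' (tmap f g t) = tmap (f' \o f) (g' \o g) t.
Proof.
apply: (tens_ext (f := tmap f' g' \o tmap f g)) => u v /=.
by rewrite !tmapE.
Qed.

Lemma eq_tmap (U U' V V' : lmodType K) (f f' : {linear U -> U'})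
    (g g' : {linear V -> V'}) :
  f =1 f' -> g =1 g' -> tmap f g =1 tmap f' g'.
Proof. by move=> ff' gg'; apply: tens_ext => u v; rewrite !tmapE ff' gg'. Qed.

Lemma tmap_id (U V : lmodType K) (f : {linear U -> U}) (g : {linear V -> V}) :
  f =1 id -> g =1 id -> tmap f g =1 id.
Proof.
by move=> fid gid; apply: (tens_ext (g := idfun)) => u v; rewrite tmapE fid gid.
Qed.

Lemma tassocV_tmap (U U' V V' W W' : lmodType K) (f : {linear U -> U'})
    (g : {linear V -> V'}) (h : {linear W -> W'}) t :
  tassocV (tmap f (tmap g h) t) = tmap (tmap f g) h (tassocV t).
Proof.
apply: (tens_ext3r (f := tassocV \o tmap f (tmap g h))
                   (g := tmap (tmap f g) h \o tassocV)) => u v w /=.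
by rewrite !tassocVE !tmapE tassocVE.
Qed.

(** This feeds an anonymous bilinear function to [tlift]. The second clause exposes the sum over the
    chosen representative, so that such a sum inherits linearity in the tensor from [F]. *)
Lemma bilinear_tlift (U V W : lmodType K) (f : U -> V -> W) :
    bilinear_for *:%R *:%R f ->
  exists2 F : {linear tensor U V -> W},
    forall u v, F (u ⊗ v) = f u v
    & forall t, F t = \sum_(p <- tens_repr t) f p.1 p.2.
Proof.
move=> f_bilin.
pose F : {bilinear U -> V -> W} :=
  HB.pack f (bilinear_isBilinear.Build K U V W *:%R *:%R f f_bilin).
by exists (tlift F) => [u v|//]; apply: tliftE.
Qed.

End TensorMapTheory.

(** * Calculus of Sweedler sums *)

Section Sweedler.
Variables (K : fieldType) (C : lmodType K).
Variable Delta : {linear C -> tensor C C}.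

(** The sum runs over the representative of [Delta c] picked by [tens_repr], so it makes sense for
    every [f]. Bilinearity of [f] is asked for only where a different representative enters. *)
Definition sweedler (V : lmodType K) (f : C -> C -> V) (c : C) : V :=
  \sum_(p <- tens_repr (Delta c)) f p.1 p.2.

Section Target.
Variable V : lmodType K.
Implicit Types f g : C -> C -> V.

Lemma sweedlerE (F : {linear tensor C C -> V}) c :
  F (Delta c) = sweedler (fun x y => F (x ⊗ y)) c.
Proof. by rewrite -[in LHS](tens_reprK (Delta c)) tens_class_sum linear_sum. Qed.

Lemma eq_sweedler f g : (forall x y, f x y = g x y) -> sweedler f =1 sweedler g.
Proof. by move=> fg c; apply: eq_bigr => p _. Qed.

Lemma sweedlerD f g c :
  sweedler (fun x y => f x y + g x y) c = sweedler f c + sweedler g c.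
Proof. exact: big_split. Qed.

Lemma sweedlerZ (a : K) f c :
  sweedler (fun x y => a *: f x y) c = a *: sweedler f c.
Proof. by rewrite /sweedler scaler_sumr. Qed.

Lemma linear_sweedler (W : lmodType K) (F : {linear V -> W}) f c :
  F (sweedler f c) = sweedler (fun x y => F (f x y)) c.
Proof. exact: linear_sum. Qed.

Lemma exchange_sweedler (f : C -> C -> C -> C -> V) c d :
  sweedler (fun x y => sweedler (f x y) d) c =
  sweedler (fun u v => sweedler (fun x y => f x y u v) c) d.
Proof. exact: exchange_big. Qed.

Lemma sweedler_linear f : bilinear_for *:%R *:%R f -> linear (sweedler f).
Proof.
by move=> /bilinear_tlift[F _ FE] a x y; rewrite /sweedler -!FE !linearP.
Qed.

Lemma sweedler_linear_param (W : lmodType K) (f : W -> C -> C -> V) c :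
  (forall x y, linear (fun w => f w x y)) -> linear (fun w => sweedler (f w) c).
Proof.
move=> f_lin a w w'; rewrite /sweedler scaler_sumr -big_split.
by apply: eq_bigr => p _; apply: f_lin.
Qed.

(** The representative of [Delta (h c)] need not be the image under [h] of that of [Delta c].
    Bilinearity lets both sides be read as values of one linear map on equal tensors. *)
Lemma sweedler_morph (h : {linear C -> C}) f c :
    bilinear_for *:%R *:%R f -> Delta (h c) = tmap h h (Delta c) ->
  sweedler f (h c) = sweedler (fun x y => f (h x) (h y)) c.
Proof.
move=> /bilinear_tlift[F Ff FE] hDelta; rewrite [LHS]/sweedler -FE hDelta.
apply: etrans (sweedlerE (F \o tmap h h) c) _.
by apply: eq_sweedler => x y /=; rewrite tmapE Ff.
Qed.

End Target.
End Sweedler.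

(** Handles the side conditions for nested Sweedler sums. A variable is either the point whose
    coproduct is taken or a parameter of the summand; the innermost expressions are linear by
    (bi)linearity of their constituents. *)
Ltac prove_linear :=
  intros;
  lazymatch goal with
  | |- bilinear_for _ _ _ => split; prove_linear
  | |- _ => first
    [ solve [apply: sweedler_linear; prove_linear]
    | solve [apply: sweedler_linear_param; prove_linear]
    | by move=> ? ? ?; rewrite /= ?(linearP, linearPl, linearPr) ]
  end.

(** * Ordinary infinitesimal bialgebras of weight [lambda] *)

Section Untwisted.
Variables (K : fieldType) (C : lmodType K) (lambda : K).
Variables (mu : {linear tensor C C -> C}) (Delta : {linear C -> tensor C C}).
Local Notation "a · b" := (mu (a ⊗ b)) (at level 40, left associativity).
Local Notation sw := (sweedler Delta).
Hypothesis mulA : forall a b c, a · (b · c) = (a · b) · c.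
Hypothesis coassoc : forall c,
  tmap Delta idfun (Delta c) = tassocV (tmap idfun Delta (Delta c)).
Hypothesis Delta_mul : forall a b,
  Delta (a · b) = tmap (mu \o ltens a) idfun (Delta b)
                + tmap idfun (mu \o rtens b) (Delta a) + lambda *: (a ⊗ b).

(** A trilinear [f] factors through a linear map [G] on threefold tensors; the two sums are the
    values of [G] at the two sides of [coassoc]. *)
Lemma sweedler_coassoc (V : lmodType K) (f : C -> C -> C -> V) c :
    (forall y z, linear (fun x => f x y z)) ->
    (forall x z, linear (fun y => f x y z)) ->
    (forall x y, linear (f x y)) ->
  sw (fun x z => sw (fun u v => f u v z) x) c =
  sw (fun x z => sw (fun u v => f x u v) z) c.
Proof.
move=> lin1 lin2 lin3.
have f_bilin z : bilinear_for *:%R *:%R (fun x y => f x y z) by split=> ?.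
(* Extends [f] to a tensor in its first two slots. Linearity in the last slot is then termwise, and
   linearity in the tensor comes from [bilinear_tlift]. *)
pose g t z := \sum_(p <- tens_repr t) f p.1 p.2 z.
have g_bilin : bilinear_for *:%R *:%R g.
  split=> [z|t] a x y.
    by have [F _ FE] := bilinear_tlift (f_bilin z); rewrite /g -!FE linearP.
  by rewrite /g /= scaler_sumr -big_split; apply: eq_bigr => p _; apply: lin3.
have gE x y z : g (x ⊗ y) z = f x y z.
  by have [F <- FE] := bilinear_tlift (f_bilin z); rewrite FE.
have [G Gg _] := bilinear_tlift g_bilin.
transitivity (G (tmap Delta idfun (Delta c))).
  apply/esym/(etrans (sweedlerE Delta (G \o tmap Delta idfun) c)).
  by apply: eq_sweedler => x z /=; rewrite tmapE Gg.
rewrite coassoc.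
apply: etrans (sweedlerE Delta (G \o tassocV \o tmap idfun Delta) c) _.
apply: eq_sweedler => x z /=; rewrite tmapE /=.
apply: etrans (sweedlerE Delta (G \o tassocV \o ltens x) z) _.
by apply: eq_sweedler => u v /=; rewrite /ltens tassocVE Gg.
Qed.

Lemma sweedler_mul (V : lmodType K) (f : C -> C -> V) a b :
    bilinear_for *:%R *:%R f ->
  sw f (a · b) = sw (fun x y => f (a · x) y) b + sw (fun x y => f x (y · b)) a
                 + lambda *: f a b.
Proof.
move=> /bilinear_tlift[F Ff FE]; rewrite [LHS]/sweedler -FE Delta_mul.
rewrite !linearD linearZ /= Ff.
congr (_ + _ + _).
  apply: etrans (sweedlerE Delta (F \o tmap (mu \o ltens a) idfun) b) _.
  by apply: eq_sweedler => x y /=; rewrite tmapE Ff.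
apply: etrans (sweedlerE Delta (F \o tmap idfun (mu \o rtens b)) a) _.
by apply: eq_sweedler => x y /=; rewrite tmapE Ff.
Qed.

Variable delta : {linear C -> tensor C C}.
Hypothesis deltaE : forall c,
  delta c = sw (fun x y => sw (fun u v => u ⊗ (x · v)) y) c.

(** The weighted Leibniz rule is used twice: for [a · b], and then for [q · b], where [q] is the
    second leg of [a]. The terms record how the three legs of [delta] are distributed between [a]
    and [b]. *)
Lemma delta_mul a b :
  delta (a · b) =
    sw (fun p q => sw (fun r s => r ⊗ (a · p · s)) q) b
    + sw (fun p q => sw (fun r s => (q · r) ⊗ (p · s)) b) a
    + sw (fun p q => sw (fun r s => r ⊗ (p · s · b)) q) a
    + lambda *: sw (fun p q => q ⊗ (p · b)) a
    + lambda *: sw (fun r s => r ⊗ (a · s)) b.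
Proof.
rewrite deltaE sweedler_mul; last by prove_linear.
congr (_ + _); rewrite -!addrA; congr (_ + _).
rewrite -sweedlerZ -!sweedlerD; apply: eq_sweedler => p q.
rewrite sweedler_mul; last by prove_linear.
by rewrite -addrA; do 2!congr (_ + _); apply: eq_sweedler => r s; rewrite mulA.
Qed.

(* delta_bar c = c2 ⊗ c4 ⊗ c1c3c5 + c4 ⊗ c2 ⊗ c1c3c5
     + lambda (c3 ⊗ c2 ⊗ c1c4 + c2 ⊗ c3 ⊗ c1c4):
   the term c3 ⊗ c2c4 ⊗ c1c5 of (id ⊗ delta) delta cancels (delta ⊗ id) delta. *)
Lemma delta_barE c :
  delta_bar delta idfun idfun c =
    sw (fun x z => sw (fun y z => sw (fun p z => sw (fun r s =>
      (y ⊗ r) ⊗ (x · p · s) + (r ⊗ y) ⊗ (x · p · s)) z) z) z) c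
    + lambda *: sw (fun x z => sw (fun y z => sw (fun r s =>
      (r ⊗ y) ⊗ (x · s) + (y ⊗ r) ⊗ (x · s)) z) z) c.
Proof.
have tassocV_sw u f d :
    tassocV (u ⊗ sw f d) = sw (fun p q => tassocV (u ⊗ f p q)) d.
  exact: (linear_sweedler Delta (tassocV \o ltens u)).
rewrite /delta_bar.
(* The five terms come from [delta_mul] applied to the product in the second leg of [delta c]. *)
have -> : tassocV (tmap (idfun \o idfun) (tmap idfun idfun \o delta) (delta c)) =
    sw (fun x y => sw (fun u v => sw (fun p q => sw (fun r s =>
      (u ⊗ r) ⊗ (x · p · s)) q) v) y) c
    + sw (fun x y => sw (fun u v => sw (fun p q => sw (fun r s =>
      (u ⊗ (q · r)) ⊗ (p · s)) v) x) y) c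
    + sw (fun x y => sw (fun u v => sw (fun p q => sw (fun r s =>
      (u ⊗ r) ⊗ (p · s · v)) q) x) y) c
    + lambda *: sw (fun x y => sw (fun u v => sw (fun p q =>
      (u ⊗ q) ⊗ (p · v)) x) y) c
    + lambda *: sw (fun x y => sw (fun u v => sw (fun r s =>
      (u ⊗ r) ⊗ (x · s)) v) y) c.
  rewrite (deltaE c) !linear_sweedler -!sweedlerD.
  apply: eq_sweedler => x y.
  rewrite !linear_sweedler -!sweedlerD; apply: eq_sweedler => u v.
  rewrite tmapE /= tmap_id // delta_mul !linearDr !linearZr !linearD !linearZ /=.
  rewrite !tassocV_sw.
  congr (_ + _ + _ + _ *: _ + _ *: _); apply: eq_sweedler => p q;
    rewrite ?tassocVE ?tassocV_sw //;
    by apply: eq_sweedler => r s; rewrite tassocVE.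
(* Sums in which each coproduct splits the last leg serve as normal form. Here the inner [delta]
   acts on the first leg [u], and two uses of coassociativity reach this form. *)
have -> : tmap (tmap idfun idfun \o delta) idfun (delta c) =
    sw (fun x z => sw (fun p z => sw (fun r z => sw (fun s v =>
      (r ⊗ (p · s)) ⊗ (x · v)) z) z) z) c.
  rewrite (deltaE c) !linear_sweedler; apply: eq_sweedler => x y.
  rewrite !linear_sweedler.
  transitivity (sw (fun u v => sw (fun p z => sw (fun r s =>
     (r ⊗ (p · s)) ⊗ (x · v)) z) u) y).
    apply: eq_sweedler => u v; rewrite tmapE /= tmap_id // deltaE.
    apply: etrans (linear_sweedler Delta (rtens (x · v)) _ _) _.
    apply: eq_sweedler => p z.
    exact: (linear_sweedler Delta (rtens (x · v))).
  rewrite sweedler_coassoc; try prove_linear.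
  apply: eq_sweedler => p z.
  by rewrite sweedler_coassoc; try prove_linear.
(* Sums splitting different legs are independent. Exchanging them brings the coproduct of [x]
   directly under that of [c], where coassociativity applies. The normal form of this term is
   exactly that of [(delta ⊗ id) delta], hence the cancellation of [t2] below. *)
have -> : sw (fun x y => sw (fun u v => sw (fun p q => sw (fun r s =>
      (u ⊗ (q · r)) ⊗ (p · s)) v) x) y) c =
    sw (fun p z => sw (fun q z => sw (fun u v => sw (fun r s =>
      (u ⊗ (q · r)) ⊗ (p · s)) v) z) z) c.
  under eq_sweedler => x y do rewrite exchange_sweedler.
  by rewrite sweedler_coassoc; try prove_linear.
have -> : sw (fun x y => sw (fun u v => sw (fun p q =>
      (u ⊗ q) ⊗ (p · v)) x) y) c =
    sw (fun p z => sw (fun q z => sw (fun u v => (u ⊗ q) ⊗ (p · v)) z) z) c.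
  under eq_sweedler => x y do rewrite exchange_sweedler.
  by rewrite sweedler_coassoc; try prove_linear.
have -> : sw (fun x y => sw (fun u v => sw (fun p q => sw (fun r s =>
      (u ⊗ r) ⊗ (p · s · v)) q) x) y) c =
    sw (fun p z => sw (fun r z => sw (fun s z => sw (fun u v =>
      (u ⊗ r) ⊗ (p · s · v)) z) z) z) c.
  under eq_sweedler => x y do rewrite exchange_sweedler.
  rewrite sweedler_coassoc; try prove_linear.
  apply: eq_sweedler => p z.
  under eq_sweedler => q y do rewrite exchange_sweedler.
  by rewrite sweedler_coassoc; try prove_linear.
have addE (V : lmodType K) (t1 t2 t3 t4 t5 : V) :
    t1 + t2 + t3 + t4 + t5 - t2 = t1 + t3 + (t4 + t5).
  by rewrite (addrAC t1) (addrAC _ t2 t4) (addrAC _ t2 t5) addrK addrA.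
rewrite addE -scalerDr -!sweedlerD; congr (_ + _ *: _).
  apply: eq_sweedler => x z; rewrite -sweedlerD.
  apply: eq_sweedler => y {}z; rewrite -sweedlerD.
  by apply: eq_sweedler => p {}z; rewrite -sweedlerD.
apply: eq_sweedler => x z; rewrite -sweedlerD.
by apply: eq_sweedler => y {}z; rewrite -sweedlerD.
Qed.

(** In [delta_barE] every summand is a pair of tensors that [Phi12] exchanges. *)
Lemma delta_bar_symmetric c :
  Phi12 C (delta_bar delta idfun idfun c) = delta_bar delta idfun idfun c.
Proof.
rewrite delta_barE linearD linearZ /=; congr (_ + _ *: _).
  rewrite linear_sweedler; apply: eq_sweedler => x z.
  rewrite linear_sweedler; apply: eq_sweedler => y {}z.
  rewrite linear_sweedler; apply: eq_sweedler => p {}z.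
  rewrite linear_sweedler; apply: eq_sweedler => r s.
  by rewrite linearD !Phi12E addrC.
rewrite linear_sweedler; apply: eq_sweedler => x z.
rewrite linear_sweedler; apply: eq_sweedler => y {}z.
rewrite linear_sweedler; apply: eq_sweedler => r s.
by rewrite linearD !Phi12E addrC.
Qed.

End Untwisted.

(** * Transfer of the pre-Lie identity along a twist *)

Section PreLieTwist.
Variables (K : fieldType) (C : lmodType K).
Variables (delta delta0 : {linear C -> tensor C C}) (psi omega : {linear C -> C}).
Hypothesis psi_omega : forall c, psi (omega c) = omega (psi c).
Hypothesis delta0_psi : forall c, delta0 (psi c) = tmap psi psi (delta0 c).
Hypothesis delta0_omega : forall c, delta0 (omega c) = tmap omega omega (delta0 c).
Hypothesis deltaE : forall c, delta c = tmap omega psi (delta0 c).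

Lemma Phi12_tmap (f g : {linear C -> C}) t :
  Phi12 C (tmap (tmap f f) g t) = tmap (tmap f f) g (Phi12 C t).
Proof.
apply: (tens_ext3l (f := Phi12 C \o tmap (tmap f f) g)
                   (g := tmap (tmap f f) g \o Phi12 C)) => x y z /=.
by rewrite !tmapE !tswapE !tmapE.
Qed.

(** Moving all twists outwards past [delta0] leaves the same powers of [omega] and [psi] on each leg
    of both terms of [delta_bar]. The first two legs carry equal maps, so [Phi12] commutes with the
    total twist. *)
Lemma delta_bar_twist c :
  delta_bar delta psi omega c =
  tmap (tmap (omega \o omega \o psi) (omega \o omega \o psi)) (psi \o psi)
    (delta_bar delta0 idfun idfun c).
Proof.
rewrite /delta_bar linearB; congr (_ - _).
  rewrite -tassocV_tmap deltaE !tmap_comp; congr (tassocV _).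
  apply: eq_tmap => x /=; first by rewrite psi_omega.
  rewrite deltaE delta0_psi !tmap_comp.
  by apply: eq_tmap.
rewrite deltaE !tmap_comp; apply: eq_tmap => x //=.
rewrite deltaE delta0_omega !tmap_comp; apply: eq_tmap => y //=.
  by rewrite !psi_omega.
by rewrite !psi_omega.
Qed.

Lemma BiHom_preLie_twist :
    (forall c, Phi12 C (delta_bar delta0 idfun idfun c) =
      delta_bar delta0 idfun idfun c) ->
  BiHom_preLie_coalgebra delta psi omega.
Proof.
move=> symm; split=> // c.
- rewrite !deltaE delta0_psi !tmap_comp.
  by apply: eq_tmap => x //=; rewrite psi_omega.
- rewrite !deltaE delta0_omega !tmap_comp.
  by apply: eq_tmap => x //=; rewrite psi_omega.
- by rewrite delta_bar_twist Phi12_tmap symm subrr.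
Qed.

End PreLieTwist.

Lemma linv_comm (K : fieldType) (U : lmodType K) (f g : {linear U -> U})
    (f_bij : bijective f) :
  (forall x, f (g x) = g (f x)) -> forall x, linv f_bij (g x) = g (linv f_bij x).
Proof. by move=> fg x; apply: (can_inj (linvK f_bij)); rewrite fg !linvVK. Qed.

(** * From a BiHom bialgebra to an ordinary one *)

Section Untwisting.
Variables (K : fieldType) (lambda : K) (C : lmodType K).
Variables (mu : {linear tensor C C -> C}) (Delta : {linear C -> tensor C C}).
Variables (alpha beta psi omega : {linear C -> C}).
Hypothesis HC : infBH_bialgebra lambda mu Delta alpha beta psi omega.
Hypotheses (alpha_bij : bijective alpha) (beta_bij : bijective beta).
Hypotheses (psi_bij : bijective psi) (omega_bij : bijective omega).
Local Notation alphaV := (linv alpha_bij).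
Local Notation betaV := (linv beta_bij).
Local Notation psiV := (linv psi_bij).
Local Notation omegaV := (linv omega_bij).

Definition untwisted_mu : {linear tensor C C -> C} := mu \o tmap alphaV betaV.
Definition untwisted_Delta : {linear C -> tensor C C} := tmap omegaV psiV \o Delta.
Local Notation mu0 := untwisted_mu.
Local Notation Delta0 := untwisted_Delta.

Lemma untwisted_muE x y : mu0 (x ⊗ y) = mu (alphaV x ⊗ betaV y).
Proof. by rewrite /mu0 /= tmapE. Qed.

Let algC := ibb_algebra HC.
Let coalgC := ibb_coalgebra HC.

Let alphaVM x y : alphaV (mu (x ⊗ y)) = mu (alphaV x ⊗ alphaV y).
Proof.
by apply: (can_inj (linvK alpha_bij)); rewrite (bha_alphaM algC) !linvVK.
Qed.

Let betaVM x y : betaV (mu (x ⊗ y)) = mu (betaV x ⊗ betaV y).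
Proof.
by apply: (can_inj (linvK beta_bij)); rewrite (bha_betaM algC) !linvVK.
Qed.

Let psiVM x y : psiV (mu (x ⊗ y)) = mu (psiV x ⊗ psiV y).
Proof.
by apply: (can_inj (linvK psi_bij)); rewrite (ibb_psiM HC) !linvVK.
Qed.

Let omegaVM x y : omegaV (mu (x ⊗ y)) = mu (omegaV x ⊗ omegaV y).
Proof.
by apply: (can_inj (linvK omega_bij)); rewrite (ibb_omegaM HC) !linvVK.
Qed.

Lemma untwisted_mulA x y z :
  mu0 (x ⊗ mu0 (y ⊗ z)) = mu0 (mu0 (x ⊗ y) ⊗ z).
Proof.
rewrite !untwisted_muE alphaVM betaVM.
(* The left factor is presented as a value of [alpha] to match [bha_assoc]. *)
rewrite -[X in mu (X ⊗ _)](linvVK alpha_bij) (bha_assoc algC) linvVK.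
congr (mu (mu (_ ⊗ _) ⊗ _)).
by apply: linv_comm => t; apply/esym/linv_comm => u; apply: (bha_comm algC).
Qed.

Lemma untwisted_mu_psi x y : mu0 (psi x ⊗ psi y) = psi (mu0 (x ⊗ y)).
Proof.
rewrite !untwisted_muE (ibb_psiM HC).
by congr (mu (_ ⊗ _)); apply: linv_comm => t;
  rewrite ?(ibb_alpha_psi HC) ?(ibb_beta_psi HC).
Qed.

Lemma untwisted_mu_omega x y : mu0 (omega x ⊗ omega y) = omega (mu0 (x ⊗ y)).
Proof.
rewrite !untwisted_muE (ibb_omegaM HC).
by congr (mu (_ ⊗ _)); apply: linv_comm => t;
  rewrite ?(ibb_alpha_omega HC) ?(ibb_beta_omega HC).
Qed.

Lemma untwisted_DeltaE c : Delta c = tmap omega psi (Delta0 c).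
Proof. by rewrite /Delta0 /= tmap_comp tmap_id // => x /=; rewrite linvVK. Qed.

Lemma untwisted_Delta_commute (f : {linear C -> C}) :
    (forall x, omega (f x) = f (omega x)) -> (forall x, psi (f x) = f (psi x)) ->
    (forall x, Delta (f x) = tmap f f (Delta x)) ->
  forall x, Delta0 (f x) = tmap f f (Delta0 x).
Proof.
move=> fomega fpsi fDelta x; rewrite /Delta0 /= fDelta !tmap_comp.
by apply: eq_tmap => y /=; rewrite linv_comm.
Qed.

Lemma untwisted_Delta_psi c : Delta0 (psi c) = tmap psi psi (Delta0 c).
Proof.
by apply: untwisted_Delta_commute => // x;
  rewrite ?(bhc_psi coalgC) ?(bhc_comm coalgC).
Qed.

Lemma untwisted_Delta_omega c : Delta0 (omega c) = tmap omega omega (Delta0 c).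
Proof.
by apply: untwisted_Delta_commute => // x;
  rewrite ?(bhc_omega coalgC) ?(bhc_comm coalgC).
Qed.

Let psi_omega := bhc_comm coalgC.

(** The injective map [T] sends the two sides to the two sides of BiHom-coassociativity,
    [(Delta ⊗ psi) Delta] and [(omega ⊗ Delta) Delta]. *)
Lemma untwisted_coassoc c :
  tmap Delta0 idfun (Delta0 c) = tassocV (tmap idfun Delta0 (Delta0 c)).
Proof.
pose T := tmap (tmap (omega \o omega) (omega \o psi)) (psi \o psi).
pose TV := tmap (tmap (omegaV \o omegaV) (psiV \o omegaV)) (psiV \o psiV).
have TK : cancel T TV.
  move=> t; rewrite /T /TV tmap_comp tmap_id // => [x|x] /=; last by rewrite !linvK.
  by rewrite tmap_comp tmap_id // => y /=; rewrite !linvK.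
have Delta_omega x : Delta (omega x) =
    tmap (omega \o omega) (omega \o psi) (Delta0 x).
  rewrite untwisted_DeltaE untwisted_Delta_omega tmap_comp.
  by apply: eq_tmap => y //=; rewrite psi_omega.
have Delta_psi x : Delta (psi x) = tmap (omega \o psi) (psi \o psi) (Delta0 x).
  by rewrite untwisted_DeltaE untwisted_Delta_psi tmap_comp; apply: eq_tmap.
apply: (can_inj TK).
transitivity (tmap Delta psi (Delta c)).
  rewrite [Delta c]untwisted_DeltaE /T !tmap_comp.
  by apply: eq_tmap => x //; apply/esym/Delta_omega.
rewrite (bhc_coassoc coalgC) [Delta c]untwisted_DeltaE /T -tassocV_tmap !tmap_comp.
by congr (tassocV _); apply: eq_tmap => x //; apply: Delta_psi.
Qed.

(** Apply [omegaV ⊗ psiV] to the compatibility condition at [alphaV x] and [betaV y], then replace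
    [Delta] by [(omega ⊗ psi) Delta0]; the twists cancel leg by leg. *)
Lemma untwisted_Delta_mul x y :
  Delta0 (mu0 (x ⊗ y)) = tmap (mu0 \o ltens x) idfun (Delta0 y)
    + tmap idfun (mu0 \o rtens y) (Delta0 x) + lambda *: (x ⊗ y).
Proof.
have omega_betaV : forall t, betaV (omega t) = omega (betaV t).
  by apply: linv_comm => t; rewrite (ibb_beta_omega HC).
have psi_alphaV : forall t, alphaV (psi t) = psi (alphaV t).
  by apply: linv_comm => t; rewrite (ibb_alpha_psi HC).
have Delta_alphaV t : Delta (alphaV t) = tmap alphaV alphaV (Delta t).
  rewrite -[in RHS](linvVK alpha_bij t) -(ibb_alpha_Delta HC) tmap_comp.
  by rewrite tmap_id // => u /=; rewrite linvK.
have Delta_betaV t : Delta (betaV t) = tmap betaV betaV (Delta t).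
  rewrite -[in RHS](linvVK beta_bij t) -(ibb_beta_Delta HC) tmap_comp.
  by rewrite tmap_id // => u /=; rewrite linvK.
transitivity (tmap omegaV psiV (Delta (mu (alphaV x ⊗ betaV y)))).
  by rewrite untwisted_muE.
rewrite (ibb_Delta_mul HC) !linearD linearZ_LR tmapE.
congr (_ + _ + _ *: (_ ⊗ _)).
- rewrite Delta_betaV [Delta y]untwisted_DeltaE 3!tmap_comp; apply: eq_tmap => u.
    apply: (etrans _ (esym (untwisted_muE x u))).
    by rewrite /= /ltens omegaVM linvK omega_betaV linvK.
  by rewrite /= linvVK linvK.
- rewrite Delta_alphaV [Delta x]untwisted_DeltaE 3!tmap_comp; apply: eq_tmap => u.
    by rewrite /= linvVK linvK.
  apply: (etrans _ (esym (untwisted_muE u y))).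
  by rewrite /= /rtens psiVM linvK psi_alphaV linvK.
- by rewrite (ibb_alpha_omega HC) /= linvK linvVK.
- by rewrite (ibb_beta_psi HC) /= linvK linvVK.
Qed.

Local Notation dstar := (Delta_star mu Delta alpha_bij beta_bij psi_bij omega_bij).
Local Notation sw := (sweedler Delta0).

(** In terms of [Delta0], [star_map] receives [(omega (omega u) ⊗ psi (omega v)) ⊗ psi y] and
    returns [omega v ⊗ psi (mu0 (u ⊗ y))]. This accounts for the powers of [psi] and [omega] in
    [Delta_star]. *)
Lemma untwisted_Delta_star c :
  tmap omegaV psiV (dstar c) =
  sw (fun x y => sw (fun u v => u ⊗ mu0 (x ⊗ v)) y) c.
Proof.
have psi_alphaV : forall t, alphaV (psi t) = psi (alphaV t).
  by apply: linv_comm => t; rewrite (ibb_alpha_psi HC).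
have psi_betaV : forall t, betaV (psi t) = psi (betaV t).
  by apply: linv_comm => t; rewrite (ibb_beta_psi HC).
pose F := tmap omegaV psiV \o
  star_map mu alpha_bij beta_bij psi_bij omega_bij \o tmap Delta idfun.
transitivity (F (tmap omega psi (Delta0 c))); first by rewrite -untwisted_DeltaE.
apply: etrans (sweedlerE Delta0 (F \o tmap omega psi) c) _.
(* The definition of [Delta_star] splits the first leg; coassociativity of [Delta0] at the end moves
   the splitting to the second. *)
transitivity (sw (fun x y => sw (fun u v => v ⊗ mu0 (u ⊗ y)) x) c).
  apply: eq_sweedler => x y.
  transitivity (tmap omegaV psiV
    (star_map mu alpha_bij beta_bij psi_bij omega_bij (Delta (omega x) ⊗ psi y))).
    by rewrite /F /= !tmapE.
  rewrite [Delta _]untwisted_DeltaE untwisted_Delta_omega tmap_comp.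
  pose G := tmap omegaV psiV \o
    star_map mu alpha_bij beta_bij psi_bij omega_bij \o rtens (psi y) \o
    tmap (omega \o omega) (psi \o omega).
  apply: etrans (sweedlerE Delta0 G x) _; apply: eq_sweedler => u v.
  transitivity (tmap omegaV psiV
    (star_map mu alpha_bij beta_bij psi_bij omega_bij
      ((omega (omega u) ⊗ psi (omega v)) ⊗ psi y))).
    exact: (congr1 (fun t => tmap omegaV psiV
      (star_map mu alpha_bij beta_bij psi_bij omega_bij (t ⊗ psi y)))
      (tmapE _ _ u v)).
  by rewrite star_mapE tmapE untwisted_muE /= psi_alphaV psi_betaV psiVM !linvK.
by rewrite (sweedler_coassoc untwisted_coassoc); try prove_linear.
Qed.

End Untwisting.

(** * Assembly of the untwisted identity and the twist *)

Theorem theorem3p38 (K : fieldType) (lambda : K) (C : lmodType K)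
    (mu : {linear tensor C C -> C}) (Delta : {linear C -> tensor C C})
    (alpha beta psi omega : {linear C -> C})
    (HC : infBH_bialgebra lambda mu Delta alpha beta psi omega)
    (alpha_bij : bijective alpha) (beta_bij : bijective beta)
    (psi_bij : bijective psi) (omega_bij : bijective omega) :
  BiHom_preLie_coalgebra
    (Delta_star mu Delta alpha_bij beta_bij psi_bij omega_bij) psi omega.
Proof.
set dstar := Delta_star _ _ _ _ _ _.
pose mu0 := untwisted_mu mu alpha_bij beta_bij.
pose Delta0 := untwisted_Delta Delta psi_bij omega_bij.
(* Defining [delta0] by untwisting [dstar] makes it a linear map at once; its Sweedler formula is
   then [delta0E]. *)
pose delta0 : {linear C -> tensor C C} := tmap (linv omega_bij) (linv psi_bij) \o dstar.
have delta0E c : delta0 c =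
    sweedler Delta0 (fun x y => sweedler Delta0 (fun u v => u ⊗ mu0 (x ⊗ v)) y) c.
  exact: (untwisted_Delta_star HC).
have psi_omega := bhc_comm (ibb_coalgebra HC).
(* Since [delta0] is built from [mu0] and [Delta0] alone, it commutes with every endomorphism of
   both; this is needed for [psi] and [omega]. *)
have delta0_commute (f : {linear C -> C}) :
    (forall x y, mu0 (f x ⊗ f y) = f (mu0 (x ⊗ y))) ->
    (forall x, Delta0 (f x) = tmap f f (Delta0 x)) ->
  forall c, delta0 (f c) = tmap f f (delta0 c).
  move=> fM fDelta c; rewrite !delta0E.
  rewrite sweedler_morph //; last by prove_linear.
  rewrite linear_sweedler; apply: eq_sweedler => x y.
  rewrite sweedler_morph //; last by prove_linear.
  rewrite linear_sweedler; apply: eq_sweedler => u v.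
  by rewrite tmapE fM.
apply: (@BiHom_preLie_twist _ _ dstar delta0) => //.
- apply: delta0_commute; last exact: (untwisted_Delta_psi HC).
  exact: (untwisted_mu_psi HC).
- apply: delta0_commute; last exact: (untwisted_Delta_omega HC).
  exact: (untwisted_mu_omega HC).
- by move=> c; rewrite tmap_comp tmap_id // => x /=; rewrite linvVK.
- apply: (@delta_bar_symmetric _ _ lambda mu0 Delta0) => //.
  + exact: (untwisted_mulA HC).
  + exact: (untwisted_coassoc HC).
  + exact: (untwisted_Delta_mul HC).
Qed.
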